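(* Let $G=(V,E)$ be a series-parallel digraph with a multiflow instance given by commodities $i\in[k]$ with source-sink pairs $(s_i,t_i)$ and demands $d_i$, and let $d_{\max}=\max_{i\in[k]}d_i$. The vector of total arc flows $(x_e)_{e\in E}$ of any (fractional) multiflow can be expressed as a convex combination of vectors of total arc flows $(y_e)_{e\in E}$ of unsplittable multiflows (for the same instance) each of which satisfies $$x_e-d_{\max}<y_e<x_e+d_{\max}\qquad\text{for every arc } e\in E.$$
   Context: Digraphs may have parallel arcs. A digraph $G=(V,E)$ is series-parallel if it has a designated start node $u_0$ and end node $v_0$ such that one of the following (recursively) holds: (1) $G$ consists of a single arc from $u_0$ to $v_0$; (2) (series composition) there are series-parallel digraphs $G_1=(V_1,E_1)$, $G_2=(V_2,E_2)$ with start/end nodes $u_1,v_1$ and $u_2,v_2$ such that $V=V_1\cup V_2$, $E$ is the disjoint union of $E_1$ and $E_2$, $u_0=u_1$, $v_1=u_2$, $v_0=v_2$, $V_1\cap V_2=\{v_1\}$; (3) (parallel composition) there are such $G_1,G_2$ with $V=V_1\cup V_2$, $E$ the disjoint union of $E_1$ and $E_2$, $u_0=u_1=u_2$, $v_0=v_1=v_2$, $V_1\cap V_2=\{u_0,v_0\}$. A multiflow instance on $G$ consists of $k\ge1$ commodities $i\in[k]=\{1,\dots,k\}$ with source-sink pairs $(s_i,t_i)\in V\times V$ and real demands $d_i>0$, where $s_i\ne t_i$ and $G$ contains an $s_i$–$t_i$ path for each $i$. A multiflow $X=(X_{e,i})_{e\in E,i\in[k]}$ consists of values $X_{e,i}\ge0$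 such that for all $v\in V$, $i\in[k]$, $\sum_{e\in\delta^+(v)}X_{e,i}-\sum_{e\in\delta^-(v)}X_{e,i}$ equals $d_i$ if $v=s_i$, $-d_i$ if $v=t_i$, and $0$ otherwise ($\delta^+(v),\delta^-(v)$ are the sets of arcs leaving and entering $v$). Its total arc flow is $x=(x_e)_{e\in E}$ with $x_e=\sum_{i\in[k]}X_{e,i}$. A multiflow is unsplittable if $X_{e,i}\in\{0,d_i\}$ for all $e,i$ and, for each $i$, the arcs $e$ with $X_{e,i}=d_i$ form an $s_i$–$t_i$ path. *)

(* Defs.v *)
From mathcomp Require Import all_boot all_order all_algebra.
From mathcomp Require Import reals.

Set Implicit Arguments.
Unset Strict Implicit.
Unset Printing Implicit Defensive.

Import Order.TTheory GRing.Theory Num.Theory.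
Local Open Scope ring_scope.

(* Arcs form a type of their own, so parallel arcs are allowed. *)
Record digraph := Digraph {
  nodes : finType;
  arcs : finType;
  src : arcs -> nodes;
  tgt : arcs -> nodes
}.

(* [sp_sub V E u v]: the subgraph of G with node set V and arc set E is
   series-parallel with start node u and end node v.  In the base case the arc
   goes from one node to a different one: with loops allowed,
   series-parallel digraphs could carry circulations, which paths cannot. *)
Inductive sp_sub (G : digraph) :
    {set nodes G} -> {set arcs G} -> nodes G -> nodes G -> Prop :=
| SpArc (e : arcs G) :
    src e != tgt e -> sp_sub [set src e; tgt e] [set e] (src e) (tgt e)
| SpSeries (V1 V2 : {set nodes G}) (E1 E2 : {set arcs G}) (u w v : nodes G) :
    sp_sub V1 E1 u w -> sp_sub V2 E2 w v ->
    V1 :&: V2 = [set w] -> [disjoint E1 & E2] ->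
    sp_sub (V1 :|: V2) (E1 :|: E2) u v
| SpParallel (V1 V2 : {set nodes G}) (E1 E2 : {set arcs G}) (u v : nodes G) :
    sp_sub V1 E1 u v -> sp_sub V2 E2 u v ->
    V1 :&: V2 = [set u; v] -> [disjoint E1 & E2] ->
    sp_sub (V1 :|: V2) (E1 :|: E2) u v.

Definition series_parallel (G : digraph) : Prop :=
  exists u0 v0 : nodes G, sp_sub [set: nodes G] [set: arcs G] u0 v0.

Section Paths.
Variable G : digraph.

Fixpoint diwalk (u : nodes G) (p : seq (arcs G)) (v : nodes G) : bool :=
  if p is e :: p' then (src e == u) && diwalk (tgt e) p' v else u == v.

(* The nodes visited by the walk p starting at u are u :: map tgt p. *)
Definition dipath (u : nodes G) (p : seq (arcs G)) (v : nodes G) : bool :=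
  diwalk u p v && uniq (u :: [seq tgt e | e <- p]).

End Paths.

Section Multiflows.
Variables (R : realType) (G : digraph) (k : nat).
Variables (s t : 'I_k -> nodes G) (d : 'I_k -> R).

Record is_instance : Prop := IsInstance {
  commodities_gt0 : (0 < k)%N;
  demand_gt0 : forall i, 0 < d i;
  source_neq_sink : forall i, s i != t i;
  source_sink_path : forall i, exists p, dipath (s i) p (t i)
}.

Record is_multiflow (X : arcs G -> 'I_k -> R) : Prop := IsMultiflow {
  multiflow_ge0 : forall e i, 0 <= X e i;
  multiflow_balance : forall v i,
    \sum_(e : arcs G | src e == v) X e i - \sum_(e : arcs G | tgt e == v) X e i
      = if v == s i then d i else if v == t i then - d i else 0
}.

Definition total_flow (X : arcs G -> 'I_k -> R) (e : arcs G) : R :=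
  \sum_(i < k) X e i.

Record is_unsplittable (X : arcs G -> 'I_k -> R) : Prop := IsUnsplittable {
  unsplittable_multiflow : is_multiflow X;
  unsplittable_values : forall e i, X e i = 0 \/ X e i = d i;
  unsplittable_path : forall i,
    exists2 p, dipath (s i) p (t i) & forall e, X e i = d i <-> e \in p
}.

(* Demands are positive and 0 < k in an instance, so the default value 0 does
   not affect the maximum. *)
Definition max_demand : R := \big[Num.max/0]_(i < k) d i.

End Multiflows.

Definition convex_combination_of (R : realType) (T : Type)
    (P : (T -> R) -> Prop) (x : T -> R) : Prop :=
  exists (n : nat) (c : 'I_n -> R) (y : 'I_n -> T -> R),
    [/\ forall j, 0 <= c j, \sum_(j < n) c j = 1, forall j, P (y j)
      & forall e, x e = \sum_(j < n) c j * y j e].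

(* Main.v *)
(* The convex combination is the law of a random unsplittable flow y with
   E(y_e) = x_e, routed from the whole graph down to its arcs along the
   series-parallel decomposition.  In a component with terminals u and v every
   commodity is surely present or surely absent, except for at most two,
   running from u to v, whose presence events A and B are disjoint or cover
   the whole space.  At an arc this forces |y_e - x_e| < d_max: if both are
   present then P(A) + P(B) > 1, and if none is then P(A) + P(B) < 1.
   In a series composition every commodity is cut at the middle node.  In a
   parallel one the commodities from u to v are lined up with A first and B
   last, and the line is cut where the flow through the first part ends; the
   event C that the commodity at the cut uses the first part must be comparable
   with the complement of A and with B, which are comparable with each other,
   so C fits into this chain, with the prescribed probability after an extra
   coin flip. *)
Require Import Defs.
From mathcomp Require Import all_boot all_order all_algebra.
From mathcomp Require Import reals lra.

Set Implicit Arguments.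
Unset Strict Implicit.
Unset Printing Implicit Defensive.

Import Order.TTheory GRing.Theory Num.Theory.
Local Open Scope ring_scope.

(** * Finite probability spaces and the choice of events in them *)

Section ProbabilitySpaces.
Variable R : realFieldType.

(** Null outcomes are excluded so that a strict inequality at one outcome makes the means differ
    strictly; the strict bounds on arc flows come from this. *)
Record pspace := PSpace {
  outcome : finType;
  weight : outcome -> R;
  weight_gt0 : forall o, 0 < weight o;
  weight_sum1 : \sum_o weight o = 1
}.

Definition mean (S : pspace) (f : outcome S -> R) : R :=
  \sum_o weight o * f o.

Definition pr (S : pspace) (A : pred (outcome S)) : R :=
  mean (fun o => (A o)%:R).

(** The map [h] preserves measure: [S'] adds fresh randomness to [S], and pulling back along [h]
    keeps all earlier events and their probabilities. *)
Definition refines (S' S : pspace) (h : outcome S' -> outcome S) : Prop :=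
  forall f : outcome S -> R, mean (fun o => f (h o)) = mean f.

Lemma refines_comp (S'' S' S : pspace) (g : outcome S'' -> outcome S')
    (h : outcome S' -> outcome S) :
  refines g -> refines h -> refines (fun o => h (g o)).
Proof. by move=> hg hh f; rewrite (hg (fun o => f (h o))) hh. Qed.

Lemma pr_refines (S' S : pspace) (h : outcome S' -> outcome S)
    (A : pred (outcome S)) :
  refines h -> pr (fun o => A (h o)) = pr A.
Proof. by move=> hh; rewrite /pr (hh (fun o => (A o)%:R)). Qed.

Section Mean.
Variable S : pspace.
Implicit Types (f g : outcome S -> R) (A B : pred (outcome S)).

Lemma eq_mean f g : f =1 g -> mean f = mean g.
Proof. by move=> fg; apply: eq_bigr => o _; rewrite fg. Qed.

Lemma eq_pr A B : A =1 B -> pr A = pr B.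
Proof. by move=> AB; apply: eq_mean => o; rewrite AB. Qed.

Lemma mean_cst c : mean (fun _ : outcome S => c) = c.
Proof. by rewrite /mean -mulr_suml weight_sum1 mul1r. Qed.

Lemma meanD f g : mean (fun o => f o + g o) = mean f + mean g.
Proof. by rewrite -big_split; apply: eq_bigr => o _; rewrite mulrDr. Qed.

Lemma meanZ c f : mean (fun o => c * f o) = c * mean f.
Proof. by rewrite mulr_sumr; apply: eq_bigr => o _; rewrite mulrCA. Qed.

Lemma mean_sum (I : finType) (f : I -> outcome S -> R) :
  mean (fun o => \sum_i f i o) = \sum_i mean (f i).
Proof.
by rewrite exchange_big; apply: eq_bigr => o _; rewrite mulr_sumr.
Qed.

Lemma le_mean f g : (forall o, f o <= g o) -> mean f <= mean g.
Proof.
by move=> fg; apply: ler_sum => o _; rewrite ler_wpM2l // ltW // weight_gt0.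
Qed.

Lemma lt_mean f g o : (forall o, f o <= g o) -> f o < g o -> mean f < mean g.
Proof.
move=> fg fgo; rewrite /mean (bigD1 o) //= [ltRHS](bigD1 o) //=.
apply: ltr_leD; first by rewrite ltr_pM2l // weight_gt0.
by apply: ler_sum => o' _; rewrite ler_wpM2l // ltW // weight_gt0.
Qed.

Lemma pr_ge0 A : 0 <= pr A.
Proof. by rewrite -[leLHS](mean_cst 0) le_mean // => o; rewrite ler0n. Qed.

Lemma pr_gt0 A o : A o -> 0 < pr A.
Proof.
move=> Ao; rewrite -[ltLHS](mean_cst 0).
by apply: (@lt_mean _ _ o) => [o'|]; rewrite ?ler0n ?Ao.
Qed.

Lemma pr_lt1 A o : ~~ A o -> pr A < 1.
Proof.
move=> Ao; rewrite -[ltRHS](mean_cst 1); apply: (@lt_mean _ _ o) => [o'|].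
  by rewrite lern1 leq_b1.
by rewrite (negPf Ao).
Qed.

Lemma le_pr A B : (forall o, A o -> B o) -> pr A <= pr B.
Proof.
by move=> AB; apply: le_mean => o; rewrite ler_nat; case: (A o) (AB o) => // ->.
Qed.

Lemma prT : pr (fun _ : outcome S => true) = 1.
Proof. exact: mean_cst. Qed.

Lemma pr0 : pr (fun _ : outcome S => false) = 0.
Proof. exact: mean_cst. Qed.

Lemma prD A B :
  pr (fun o => A o && B o) + pr (fun o => A o && ~~ B o) = pr A.
Proof.
rewrite -meanD; apply: eq_mean => o.
by case: (A o); case: (B o); rewrite /= ?addr0 ?add0r.
Qed.

End Mean.

(* The new set adds to [A] a fraction of [B \ A] selected by an independent
   biased coin. *)
Lemma pr_interpolation (S : pspace) (A B : pred (outcome S)) (g : R) :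
    (forall o, A o -> B o) -> pr A <= g <= pr B ->
  exists (S' : pspace) (h : outcome S' -> outcome S) (C : pred (outcome S')),
    [/\ refines h, forall o, A (h o) -> C o, forall o, C o -> B (h o)
      & pr C = g].
Proof.
move=> AB /andP[Ag gB].
(* The extreme values of [g] are treated apart because both sides of the coin must have positive
   weight. *)
have [gA|ngA] := eqVneq g (pr A).
  by exists S, id, A; split=> //; exact: AB.
have [gB'|ngB] := eqVneq g (pr B).
  by exists S, id, B; split=> //; exact: AB.
have Alt : pr A < g by rewrite lt_neqAle eq_sym ngA.
have ltB : g < pr B by rewrite lt_neqAle ngB.
pose la := (g - pr A) / (pr B - pr A).
have la0 : 0 < la by apply: divr_gt0; lra.
have la1 : la < 1 by rewrite /la ltr_pdivrMr; lra.
pose w (o : outcome S * bool) := weight o.1 * (if o.2 then la else 1 - la).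
have wE (f : outcome S * bool -> R) : \sum_o w o * f o =
    \sum_o weight o * (la * f (o, true) + (1 - la) * f (o, false)).
  transitivity (\sum_(o : outcome S) \sum_(b : bool) w (o, b) * f (o, b)).
    by rewrite pair_bigA; apply: eq_bigr => -[].
  by apply: eq_bigr => o _; rewrite big_bool /w /=; lra.
have w0 o : 0 < w o.
  by rewrite /w mulr_gt0 ?weight_gt0 //; case: o.2 => //; lra.
have w1 : \sum_o w o = 1.
  rewrite -[RHS](weight_sum1 S); under eq_bigr do rewrite -[w _]mulr1.
  by rewrite wE; apply: eq_bigr => o _; rewrite !mulr1 subrKC mulr1.
exists (PSpace w0 w1), fst, (fun o => A o.1 || (B o.1 && o.2)); split.
- by move=> f; rewrite /mean /= wE; apply: eq_bigr => o _; congr (_ * _); lra.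
- by move=> o ->.
- by move=> o /orP[/AB|/andP[]].
rewrite /pr /mean /= wE /=.
transitivity (mean (fun o => (1 - la) * (A o)%:R + la * (B o)%:R)).
  apply: eq_bigr => o _; congr (_ * _); move: (AB o).
  by case: (A o) => [->|_] //=; case: (B o) => /=; lra.
rewrite meanD !meanZ -/(pr A) -/(pr B).
suff : la * (pr B - pr A) = g - pr A by lra.
by rewrite /la divfK //; apply/eqP; lra.
Qed.

(** Equivalently, [A] is comparable under inclusion with the complement of [B]. *)
Definition uncrossed (S : pspace) (A B : pred (outcome S)) : Prop :=
  (forall o, ~~ (A o && B o)) \/ (forall o, A o || B o).

Definition decided (S : pspace) (A : pred (outcome S)) : Prop :=
  (forall o, A o) \/ (forall o, ~~ A o).

Lemma uncrossedC (S : pspace) (A B : pred (outcome S)) :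
  uncrossed A B -> uncrossed B A.
Proof.
by case=> H; [left|right] => o; rewrite ?(andbC (B o)) ?(orbC (B o)).
Qed.

Lemma decided_uncrossed (S : pspace) (A B : pred (outcome S)) :
  decided A -> uncrossed A B.
Proof. by case=> H; [right|left] => o; rewrite ?H // (negPf (H o)). Qed.

(** If [A] and [Q] are disjoint, any [C] inside [A] works. If they cover the space, [C] is taken
    inside [A && Q] when it fits there, so that the rest of [A] still covers with [Q]; otherwise [C]
    swallows [A && Q] and the rest of [A] is disjoint from [Q]. *)
Lemma split_uncrossed (S : pspace) (A Q : pred (outcome S)) (g : R) :
    uncrossed A Q -> 0 <= g <= pr A ->
  exists (S' : pspace) (h : outcome S' -> outcome S) (C : pred (outcome S')),
    [/\ refines h, forall o, C o -> A (h o), pr C = g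
      & uncrossed (fun o => A (h o) && ~~ C o) (fun o => Q (h o))].
Proof.
move=> gAQ /andP[g0 gA].
have [dAQ|cAQ] := gAQ.
  have [||S' [h [C [rh _ CA prC]]]] := @pr_interpolation S xpred0 A g => //.
    by rewrite pr0 g0.
  exists S', h, C; split=> //; left=> o; move: (dAQ (h o)).
  by case: (A _); case: (Q _); case: (C o).
have [gAQ'|gAQ'] := leP g (pr (fun o => A o && Q o)).
  have [||S' [h [C [rh _ CA prC]]]] :=
      @pr_interpolation S xpred0 (fun o => A o && Q o) g => //.
    by rewrite pr0 g0.
  exists S', h, C; split=> // [o /CA/andP[]//|]; right=> o.
  move: (cAQ (h o)) (CA o); case: (A _); case: (Q _); case: (C o) => //=.
  by move=> _ /(_ isT).
have [||S' [h [C [rh AC CA prC]]]] :=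
    @pr_interpolation S (fun o => A o && Q o) A g => //.
- by move=> o /andP[].
- by rewrite gA ltW.
exists S', h, C; split=> //; left=> o; move: (AC o).
by case: (A _); case: (Q _); case: (C o) => //= /(_ isT).
Qed.

(** This serves a cut commodity that is surely present. Both requirements on [C] are
    comparabilities, with [~ P] and with [Q], and these two are comparable by hypothesis. *)
Lemma split_full (S : pspace) (P Q : pred (outcome S)) (g : R) :
    uncrossed P Q -> 0 <= g <= 1 ->
  exists (S' : pspace) (h : outcome S' -> outcome S) (C : pred (outcome S')),
    [/\ refines h, pr C = g, uncrossed (fun o => P (h o)) C
      & uncrossed (fun o => ~~ C o) (fun o => Q (h o))].
Proof.
move=> gPQ /andP[g0 g1].
(* [C] is inserted into the chain formed by [~ P] and [Q]. *)
suff [D1 [D2 [sD chain bnds]]] : exists D1 D2 : pred (outcome S),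
    [/\ forall o, D1 o -> D2 o,
      (forall o, P o || D1 o) \/ (forall o, ~~ (P o && D2 o)),
      (forall o, Q o -> D1 o) \/ (forall o, D2 o -> Q o)
      & pr D1 <= g <= pr D2].
  move=> bg; have [S' [h [C [rh DC CD prC]]]] := pr_interpolation sD bg.
  exists S', h, C; split=> //.
  - case: chain => H; [right|left] => o.
      by move: (H (h o)) (DC o); case: (P _) => //= -> /(_ isT).
    move: (H (h o)) (CD o); case: (P _) => //=; case: (C o) => //= /negPf->.
    by move/(_ isT).
  - case: bnds => H; [left|right] => o.
      move: (H (h o)) (DC o); case: (Q _); case: (C o) => //= /(_ isT) ->.
      by move/(_ isT).
    by move: (H (h o)) (CD o); case: (C o) => //= H1 /(_ isT).
(* The chain runs from the empty to the full event through [Q] and then [~ P] if [P] and [Q] are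
   disjoint, through [~ P] and then [Q] if they cover. [D1] and [D2] are neighbours in it whose
   probabilities enclose [g]. *)
case: gPQ => PQ.
- have QP o : Q o -> ~~ P o by move: (PQ o); case: (P o); case: (Q o).
  have [gQ|gQ] := leP g (pr Q).
    exists xpred0, Q; split=> //; [|by right|by rewrite pr0 g0].
    by right.
  have [gP|gP] := leP g (pr (fun o => ~~ P o)).
    exists Q, (fun o => ~~ P o); split=> //; [|by left|by rewrite ltW].
    by right=> o; rewrite andbN.
  exists (fun o => ~~ P o), xpredT; split=> //; last by rewrite prT g1 ltW.
    by left=> o; rewrite orbN.
  by left.
- have QP o : ~~ P o -> Q o by move: (PQ o); case: (P o); case: (Q o).
  have [gP|gP] := leP g (pr (fun o => ~~ P o)).
    exists xpred0, (fun o => ~~ P o); split=> //; [|by right|by rewrite pr0 g0].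
    by right=> o; rewrite andbN.
  have [gQ|gQ] := leP g (pr Q).
    exists (fun o => ~~ P o), Q; split=> //; [|by right|by rewrite ltW].
    by left=> o; rewrite orbN.
  exists Q, xpredT; split=> //; [|by left|by rewrite prT g1 ltW].
  left=> o; exact: PQ.
Qed.

Lemma uncrossed_refines (S' S : pspace) (h : outcome S' -> outcome S)
    (A B : pred (outcome S)) :
  uncrossed A B -> uncrossed (fun o => A (h o)) (fun o => B (h o)).
Proof. by case=> H; [left|right] => o. Qed.

Lemma decided_refines (S' S : pspace) (h : outcome S' -> outcome S)
    (A : pred (outcome S)) :
  decided A -> decided (fun o => A (h o)).
Proof. by case=> H; [left|right] => o. Qed.

Lemma decided_and (S : pspace) (A : pred (outcome S)) (b : bool) :
  decided A -> decided (fun o => A o && b).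
Proof.
by case: b => -[H|H]; [left|right|right|right] => o; rewrite ?andbT ?andbF.
Qed.

Lemma decided_pr (S : pspace) (A : pred (outcome S)) o :
  decided A -> pr A = (A o)%:R.
Proof.
case=> H; first by rewrite H -(prT S); apply: eq_pr.
by rewrite (negPf (H o)) mulr0n -(pr0 S); apply: eq_pr => o'; apply: negPf.
Qed.

(** * Commodities that are present at random *)

Section Commodities.
Variables (I : finType) (d : I -> R) (dm : R).
Hypotheses (d_gt0 : forall i, 0 < d i) (d_le : forall i, d i <= dm).

(** The two exceptional commodities may coincide, which covers the case of at most one undecided
    commodity. *)
Definition balanced (S : pspace) (B : I -> pred (outcome S)) : Prop :=
  exists i j, (forall l, l != i -> l != j -> decided (B l)) /\
              (i != j -> uncrossed (B i) (B j)).

Lemma balanced_refines (S' S : pspace) (h : outcome S' -> outcome S)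
    (B : I -> pred (outcome S)) :
  balanced B -> balanced (fun l o => B l (h o)).
Proof.
move=> [i [j [dB uB]]]; exists i, j; split=> [l li lj|/uB].
  by apply: decided_refines; apply: dB.
exact: uncrossed_refines.
Qed.

(** A decided event is uncrossed with every event, so commodities can be made decided one by one
    without harm. *)
Lemma balanced_mix (S : pspace) (B C : I -> pred (outcome S)) :
    balanced B -> (forall l, C l =1 B l \/ decided (C l)) -> balanced C.
Proof.
move=> [i [j [dB uB]]] CB; exists i, j; split=> [l li lj|ij].
  case: (CB l) => // CBl; case: (dB l li lj) => H; [left|right] => o;
  by rewrite CBl.
case: (CB i) => [Ci|]; last exact: decided_uncrossed.
case: (CB j) => [Cj|]; last by move=> dj; apply/uncrossedC/decided_uncrossed.
by case: (uB ij) => H; [left|right] => o; rewrite Ci Cj.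
Qed.

(** Only the terms of [i] and [j] survive, each smaller in size than its demand. With one present
    and one absent the signs are opposite; the other two cases need the bounds [both] and [none] on
    the sum of the probabilities. *)
Lemma balanced_deviation (S : pspace) (B : I -> pred (outcome S)) o :
  balanced B -> `|\sum_l d l * ((B l o)%:R - pr (B l))| < dm.
Proof.
move=> [i [j [dB uB]]].
have pr_bounds l : 0 <= pr (B l) <= 1.
  by rewrite pr_ge0 -(prT S) le_pr.
have others l : l != i -> l != j -> d l * ((B l o)%:R - pr (B l)) = 0.
  by move=> li lj; rewrite (decided_pr o (dB l li lj)) subrr mulr0.
have [di0 dim] := (d_gt0 i, d_le i).
have [dj0 djm] := (d_gt0 j, d_le j).
have bi : if B i o then 0 < pr (B i) else pr (B i) < 1.
  by case: ifPn => Bo; [exact: pr_gt0 Bo|exact: pr_lt1 Bo].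
have bj : if B j o then 0 < pr (B j) else pr (B j) < 1.
  by case: ifPn => Bo; [exact: pr_gt0 Bo|exact: pr_lt1 Bo].
have [/andP[ai0 ai1] /andP[aj0 aj1]] := (pr_bounds i, pr_bounds j).
rewrite (bigD1 i) //=.
have [ij|ij] := eqVneq i j.
  rewrite big1 => [|l li]; last by rewrite others // -ij.
  rewrite addr0 ltr_norml; move: bi; case: (B i o) => /= bi; nra.
rewrite (bigD1 j) 1?eq_sym //= big1 ?addr0 => [|l /andP[]]; last exact: others.
have sumE : pr (B i) + pr (B j) = mean (fun o => (B i o)%:R + (B j o)%:R).
  by rewrite meanD.
(* Joint presence at [o] excludes disjointness, so the events cover: the sum of their indicators is
   at least 1 everywhere and is 2 at [o]. The bound [none] is dual. *)
have both : B i o -> B j o -> 1 < pr (B i) + pr (B j).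
  move=> Bi Bj; rewrite sumE -[ltLHS](mean_cst S 1).
  case: (uB ij) => H; first by move: (H o); rewrite Bi Bj.
  apply: (@lt_mean _ _ _ o) => [o'|]; rewrite ?Bi ?Bj ?ltrDl //.
  by move: (H o'); case: (B i o'); case: (B j o') => //= _; lra.
have none : ~~ B i o -> ~~ B j o -> pr (B i) + pr (B j) < 1.
  move=> /negPf Bi /negPf Bj; rewrite sumE -[ltRHS](mean_cst S 1).
  case: (uB ij) => H; last by move: (H o); rewrite Bi Bj.
  apply: (@lt_mean _ _ _ o) => [o'|]; rewrite ?Bi ?Bj ?add0r //.
  by move: (H o'); case: (B i o'); case: (B j o') => //= _; lra.
rewrite ltr_norml; move: bi bj both none.
case: (B i o); case: (B j o) => /= bi bj both none.
- by have {both none} := both isT isT; nra.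
- by clear both none; nra.
- by clear both none; nra.
- by have {both none} := none isT isT; nra.
Qed.

(** The cut [x] is the first element at which the running sum reaches [f]. *)
Lemma prefix_cut (T : Type) (a : T -> R) (s : seq T) (f : R) :
    0 <= f <= \sum_(x <- s) a x -> (0 < size s)%N ->
  exists s1 x s2, s = s1 ++ x :: s2 /\ 0 <= f - \sum_(y <- s1) a y <= a x.
Proof.
elim: s f => // x s IHs f; rewrite big_cons => /andP[f0 fle] _.
have [fx|xf] := leP f (a x).
  by exists [::], x, s; rewrite big_nil subr0 f0.
case: s => [|y s] in IHs fle *; first by move: fle; rewrite big_nil; lra.
have [|//|s1 [z [s2 [-> bz]]]] := IHs (f - a x).
  by apply/andP; split; lra.
by exists (x :: s1), z, s2; rewrite big_cons opprD addrA.
Qed.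

(** Here [s] is the part of the line strictly before the cut [l]. As [i] heads the line and [j] ends
    it, [i] precedes any other cut, and [j] precedes none unless it is [i]. *)
Lemma ordered_cut (a : I -> R) (i j : I) (f : R) :
    0 <= f <= \sum_l a l ->
  exists (s : pred I) (l : I), [/\ ~~ s l, l != i -> s i, s j -> j = i
    & 0 <= f - \sum_(m | s m) a m <= a l].
Proof.
set r := [seq m <- enum I | (m != i) && (m != j)].
set s := i :: r ++ (if i == j then [::] else [:: j]).
have s_all m : m \in s.
  rewrite /s inE mem_cat mem_filter mem_enum andbT.
  have [//|mi] := eqVneq m i; have [mj|mj //] := eqVneq m j; rewrite /=.
  by rewrite -mj eq_sym (negPf mi) inE.
have s_uniq : uniq s.
  rewrite /s /= mem_cat mem_filter eqxx cat_uniq filter_uniq ?enum_uniq //=.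
  case: (eqVneq i j) => ij //=; rewrite inE (negPf ij) /= orbF andbT.
  by rewrite mem_filter eqxx andbF.
have sumE : \sum_l a l = \sum_(l <- s) a l.
  by rewrite -big_enum; apply/perm_big/uniq_perm; rewrite ?enum_uniq // => m;
    rewrite mem_enum s_all.
rewrite sumE => bf.
have [//|s1 [l [s2 [sE bl]]]] := prefix_cut bf.
have [us1 ls1] : uniq s1 /\ l \notin s1.
  move: s_uniq; rewrite sE cat_uniq => /and3P[-> /norP[/= ls1 _] _].
  by split.
exists (mem s1), l; split.
- by [].
- move: sE; rewrite /s; case: (s1) => [|x s1'] [-> _]; first by rewrite eqxx.
  by rewrite /= inE eqxx.
- move=> js1; apply/eqP; apply: contraT; rewrite eq_sym => ij.
  have sl : last i s = j by rewrite /s (negPf ij) /= last_cat.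
  have : j \in l :: s2.
    by rewrite -sl sE last_cat /=; apply: mem_last.
  move: s_uniq; rewrite sE cat_uniq => /and3P[_ /hasPn/(_ j) H _] /H /negP[].
  exact: js1.
- by rewrite -big_uniq.
Qed.

Lemma split_event (S : pspace) (A P Q : pred (outcome S)) (g : R) :
    decided A -> uncrossed P Q -> 0 <= g <= pr A ->
  exists (S' : pspace) (h : outcome S' -> outcome S) (C : pred (outcome S')),
    [/\ refines h, forall o, C o -> A (h o), pr C = g,
      uncrossed (fun o => P (h o)) C
      & uncrossed (fun o => A (h o) && ~~ C o) (fun o => Q (h o))].
Proof.
case=> HA uPQ gA.
  have [|S' [h [C [rh prC uPC uCQ]]]] := split_full uPQ (g := g).
    by move: gA; rewrite (eq_pr HA) prT.
  exists S', h, C; split=> //.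
  by case: uCQ => H; [left|right] => o; rewrite HA ?H.
exists S, id, xpred0; split=> //.
- have prA : pr A = 0 by rewrite -(pr0 S); apply: eq_pr => o; apply: negPf.
  by move: gA; rewrite prA pr0 => ?; lra.
- by left=> o; rewrite andbF.
- by left=> o; rewrite (negPf (HA o)).
Qed.

(** Commodities before the cut [l] go wholly to [C], those after it wholly to the rest, and only [l]
    is divided. The exceptional pair is then [i], [l] for [C] and [l], [j] for the rest. *)
Lemma balanced_split (S : pspace) (B : I -> pred (outcome S)) (f : R) :
    balanced B -> 0 <= f <= \sum_l d l * pr (B l) ->
  exists (S' : pspace) (h : outcome S' -> outcome S)
      (C : I -> pred (outcome S')),
    [/\ refines h, forall l o, C l o -> B l (h o),
      \sum_l d l * pr (C l) = f, balanced C
      & balanced (fun l o => B l (h o) && ~~ C l o)].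
Proof.
move=> [i [j [dB uB]]] bf.
have [s [l [sl si sj bl]]] := ordered_cut i j bf.
(* The probability with which [l] must use the first part for the mean flow there to be exactly
   [f]. *)
set g := (f - \sum_(m | s m) d m * pr (B m)) / d l.
have bg : 0 <= g <= pr (B l).
  by rewrite /g divr_ge0 ?ler_pdivrMr ?(ltW (d_gt0 l)) //; lra.
have [S' [h [C [rh CB prC u1 u2]]]] : exists (S' : pspace)
    (h : outcome S' -> outcome S) (C : pred (outcome S')),
    [/\ refines h, forall o, C o -> B l (h o), pr C = g,
      l != i -> uncrossed (fun o => B i (h o)) C
      & l != j -> i != j ->
        uncrossed (fun o => B l (h o) && ~~ C o) (fun o => B j (h o))].
  have uQ : uncrossed (B i) (if i == j then xpred0 else B j).
    by case: ifPn => [_|/uB //]; left=> o; rewrite andbF.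
  have [li|li] := eqVneq l i.
    move: bg; rewrite {}li => bg.
    have [S' [h [C [rh CB prC uC]]]] := split_uncrossed uQ bg.
    exists S', h, C; split=> // _ ij.
    by move: uC; rewrite (negPf ij).
  (* For [l = j] the roles are exchanged: the share left over, of probability [pr (B j) - g], is
     split off first, and its complement in [B j] is the event sought, uncrossed with [B i]. *)
  have [lj|lj] := eqVneq l j.
    move: bg li; rewrite {}lj => bg ji; have ij : i != j by rewrite eq_sym.
    have [|S' [h [C [rh CB prC uC]]]] :=
        split_uncrossed (uncrossedC (uB ij)) (g := pr (B j) - g).
      by move/andP: bg => [g0 gj]; apply/andP; split; lra.
    exists S', h, (fun o => B j (h o) && ~~ C o); split=> //.
    + by move=> o /andP[].
    + have := prD (fun o => B j (h o)) C; rewrite (pr_refines _ rh).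
      rewrite (eq_pr (B := C)) ?prC => [|o]; first by lra.
      by rewrite andb_idl //; apply: CB.
    + by move=> _; apply: uncrossedC.
  have [S' [h [C [rh CB prC uPC uCQ]]]] := split_event (dB l li lj) uQ bg.
  exists S', h, C; split=> // _ ij.
  by move: uCQ; rewrite (negPf ij).
exists S', h, (fun m o => if m == l then C o else B m (h o) && s m); split=> //.
- by move=> m o; case: eqP => [->|_ /andP[]//]; apply: CB.
- rewrite (bigD1 l) //= eqxx prC /g mulrC divfK ?gt_eqF //.
  rewrite [X in _ - X]big_mkcond (bigD1 l) //= (negPf sl) add0r.
  rewrite -[RHS](subrK (\sum_(m | m != l) if s m then d m * pr (B m) else 0)).
  congr (_ + _); apply: eq_bigr => m /negPf ml; rewrite ml.
  case: (s m).
    rewrite -(pr_refines _ rh); congr (_ * _).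
    by apply: eq_pr => o; rewrite andbT.
  by rewrite (eq_pr (B := xpred0)) ?pr0 ?mulr0 // => o; rewrite andbF.
- exists i, l; split=> [m mi /negPf ml|il].
    rewrite ml; have [mj|mj] := eqVneq m j.
      have -> : s m = false.
        by apply: contraNF mi; rewrite mj => /sj->.
      by right=> o; rewrite andbF.
    by apply: decided_and; apply: decided_refines; apply: dB.
  rewrite eqxx (negPf il) si 1?eq_sym //.
  have {}u1 := u1 (contra_neq (@esym _ _ _) il).
  by case: u1 => H; [left|right] => o; rewrite andbT.
- exists l, j; split=> [m /negPf ml mj|lj].
    rewrite ml; have [mi|mi] := eqVneq m i.
      by rewrite mi si -?mi 1?eq_sym ?ml //; right=> o; rewrite andbT andbN.
    have dm' : decided (fun o => B m (h o) && ~~ s m).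
      by apply: decided_and; apply: decided_refines; apply: dB.
    by case: dm' => H; [left|right] => o; move: (H o); case: (B m _).
  rewrite eqxx eq_sym (negPf lj).
  have [ij|ij] := eqVneq i j.
    rewrite -ij si ?ij //; apply/uncrossedC/decided_uncrossed.
    by right=> o; rewrite andbT andbN.
  have -> : s j = false by apply: contraNF ij => /sj->.
  by case: (u2 lj ij) => H; [left|right] => o; rewrite andbF andbT.
Qed.

End Commodities.

End ProbabilitySpaces.

(** * Flows in series and parallel compositions *)

Section Flows.
Variables (R : realFieldType) (G : digraph).
Implicit Types (V : {set nodes G}) (E : {set arcs G}) (x : arcs G -> R).
Implicit Types (u v w z : nodes G) (e : arcs G).

(** What the flow arguments retain of the recursive structure. Barring arcs into [u] and out of [v]
    gives the net outflow a sign at each terminal. *)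
Definition terminals V E u v : Prop :=
  [/\ u \in V, v \in V, u != v
    & forall e, e \in E ->
        [/\ src e \in V, tgt e \in V, tgt e != u & src e != v]].

Lemma sp_terminals V E u v : sp_sub V E u v -> terminals V E u v.
Proof.
elim=> {V E u v} [e neq|V1 V2 E1 E2 u w v _ [u1 w1 uw H1] _ [w2 v2 wv H2] VV _
                 |V1 V2 E1 E2 u v _ [u1 v1 uv H1] _ [u2 v2 _ H2] VV _].
- split; rewrite ?inE ?eqxx ?orbT // => e'; rewrite inE => /eqP->.
  by split; rewrite ?inE ?eqxx ?orbT // eq_sym.
- have V12 z : z \in V1 -> z \in V2 -> z = w.
    by move=> z1 z2; apply/set1P; rewrite -VV inE z1.
  split; rewrite ?inE ?u1 ?v2 ?orbT //.
    by apply: contra_neq uw => uv; apply: V12; rewrite // uv.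
  move=> e; rewrite inE => /orP[/H1|/H2] [se te tu sv].
    split; rewrite ?inE ?se ?te //.
    apply: contra_neq sv => sv; apply: V12; rewrite // sv.
    exact: v2.
  split; rewrite ?inE ?se ?te ?orbT //.
  apply: contra_neq tu => tu; apply: V12; rewrite // tu.
  exact: u1.
- split; rewrite ?inE ?u1 ?v1 //.
  by move=> e; rewrite inE => /orP[/H1|/H2] [se te tu sv];
    split; rewrite ?inE ?se ?te ?orbT.
Qed.

Definition net E x z : R :=
  \sum_(e in E | src e == z) x e - \sum_(e in E | tgt e == z) x e.

(** With [a = b] this is conservation at every node, the case of a commodity retracted to one
    point. *)
Definition is_flow E x (D : R) (a b : nodes G) : Prop :=
  forall z, net E x z = D * ((z == a)%:R - (z == b)%:R).

Lemma eq_net E x y : {in E, x =1 y} -> net E x =1 net E y.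
Proof.
by move=> xy z; congr (_ - _); apply: eq_bigr => e /andP[/xy].
Qed.

Lemma net_sum0 E x : \sum_z net E x z = 0.
Proof.
rewrite sumrB -(partition_big (fun e => src e) xpredT) //=.
by rewrite -(partition_big (fun e => tgt e) xpredT) ?subrr.
Qed.

Lemma netZ E x c z : net E (fun e => x e * c) z = net E x z * c.
Proof. by rewrite /net -!mulr_suml mulrBl. Qed.

Lemma net_sum (I : finType) (P : pred I) E (x : arcs G -> I -> R) z :
  net E (fun e => \sum_(i | P i) x e i) z = \sum_(i | P i) net E (x^~ i) z.
Proof. by rewrite sumrB; congr (_ - _); apply: exchange_big. Qed.

Lemma netU E1 E2 x z : [disjoint E1 & E2] ->
  net (E1 :|: E2) x z = net E1 x z + net E2 x z.
Proof.
move=> dE; rewrite /net !big_mkcondr.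
have bU (F : arcs G -> R) :
    \sum_(e in E1 :|: E2) F e = \sum_(e in E1) F e + \sum_(e in E2) F e.
  by rewrite -bigU //; apply: eq_bigl => e; rewrite !inE.
by rewrite !bU opprD addrACA.
Qed.

Lemma net_set1 e x z :
  net [set e] x z = (src e == z)%:R * x e - (tgt e == z)%:R * x e.
Proof.
rewrite /net !big_mkcondr !big_set1.
by case: (src e == z); case: (tgt e == z); rewrite ?mul1r ?mul0r.
Qed.

Section Bounded.
Variables (V : {set nodes G}) (E : {set arcs G}) (u v : nodes G).
Hypothesis hE : terminals V E u v.

Lemma net_outside x z : z \notin V -> net E x z = 0.
Proof.
case: hE => _ _ _ H zV; rewrite /net !big1 ?subrr // => e /andP[/H[se te _ _]].
  by move/eqP=> ez; rewrite -ez te in zV.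
by move/eqP=> ez; rewrite -ez se in zV.
Qed.

Lemma net_source_ge0 x : (forall e, 0 <= x e) -> 0 <= net E x u.
Proof.
case: hE => _ _ _ H x0; rewrite /net [X in _ - X]big1 ?subr0 ?sumr_ge0 //.
by move=> e /andP[/H[_ _ /negPf->]].
Qed.

Lemma net_sink_le0 x : (forall e, 0 <= x e) -> net E x v <= 0.
Proof.
case: hE => _ _ _ H x0.
rewrite /net [X in X - _]big1 ?sub0r ?oppr_le0 ?sumr_ge0 //.
by move=> e /andP[/H[_ _ _ /negPf->]].
Qed.

Lemma net_two_points x : (forall z, z != u -> z != v -> net E x z = 0) ->
  is_flow E x (net E x u) u v.
Proof.
case: hE => _ _ uv _ H z.
have := net_sum0 E x; rewrite (bigD1 u) //= (bigD1 v) 1?eq_sym //= big1.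
  rewrite addr0 => /eqP; rewrite addr_eq0 => /eqP netu.
  have [->|zu] := eqVneq z u; first by rewrite (negPf uv) subr0 mulr1.
  have [->|zv] := eqVneq z v; first by rewrite netu sub0r mulrN1 opprK.
  by rewrite subrr mulr0 H.
by move=> z' /andP[]; apply: H.
Qed.

End Bounded.

(* [retract V w] sends all of a graph glued to [V] at [w] to the point [w]. *)
Definition retract V w z := if z \in V then z else w.

(** Away from [w], a node of [V1] meets no arc of [E2], so its balance is that of the whole. The
    balance at [w] follows because both sides sum to zero over all nodes. *)
Lemma flow_series V1 E1 u1 v1 V2 E2 u2 v2 w x D a b :
    terminals V1 E1 u1 v1 -> terminals V2 E2 u2 v2 ->
    V1 :&: V2 = [set w] -> [disjoint E1 & E2] ->
    is_flow (E1 :|: E2) x D a b ->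
  is_flow E1 x D (retract V1 w a) (retract V1 w b).
Proof.
move=> T1 T2 VV dE xf.
have wV1 : w \in V1 by have := set11 w; rewrite -VV inE => /andP[].
have rV a' : retract V1 w a' \in V1 by rewrite /retract; case: ifP.
pose g z := D * ((z == retract V1 w a)%:R - (z == retract V1 w b)%:R).
have offw z : z != w -> net E1 x z = g z.
  move=> zw; have [zV1|zV1] := boolP (z \in V1); last first.
    rewrite (net_outside T1) // /g.
    have nr a' : (z == retract V1 w a') = false.
      by apply: contraNF zV1 => /eqP->.
    by rewrite !nr subrr mulr0.
  have zV2 : z \notin V2.
    by apply: contra_neqN zw => zV2; apply/set1P; rewrite -VV inE zV1.
  have := xf z; rewrite netU // (net_outside T2) // addr0 => ->.
  have er a' : (z == retract V1 w a') = (z == a').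
    rewrite /retract; case: ifPn => // a'V; rewrite (negPf zw).
    by apply/esym; apply: contraNF a'V => /eqP<-.
  by rewrite /g !er.
move=> z; have [->|/offw//] := eqVneq z w.
have sg : \sum_z g z = 0.
  have s1 a' : \sum_z (z == a')%:R = 1 :> R.
    by rewrite (bigD1 a') //= eqxx big1 ?addr0 // => ? /negPf->.
  by rewrite -mulr_sumr sumrB !s1 subrr mulr0.
have : \sum_z net E1 x z = \sum_z g z by rewrite sg net_sum0.
by rewrite (bigD1 w) //= [RHS](bigD1 w) //= (eq_bigr g) => [/addIr|z' /offw].
Qed.

Section Parallel.
Variables (V1 V2 : {set nodes G}) (E1 E2 : {set arcs G}) (u v : nodes G).
Hypotheses (T1 : terminals V1 E1 u v) (T2 : terminals V2 E2 u v).
Hypotheses (VV : V1 :&: V2 = [set u; v]) (dE : [disjoint E1 & E2]).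
Variables (x : arcs G -> R) (D : R) (a b : nodes G).
Hypothesis x_ge0 : forall e, 0 <= x e.
Hypothesis xf : is_flow (E1 :|: E2) x D a b.

Let netE z : net E1 x z + net E2 x z = D * ((z == a)%:R - (z == b)%:R).
Proof. by rewrite -xf netU. Qed.

Let V12 z : z \in V1 -> z \in V2 -> z = u \/ z = v.
Proof.
by move=> z1 z2; apply/set2P; rewrite -VV inE z1.
Qed.

(** The net flow in [E2] can only run from [u] to [v]. Both parts send a nonnegative net amount out
    of [u] and into [v], whereas the balance of the commodity allows no positive total at [u] if
    [a != u], or at [v] if [b != v]. *)
Lemma parallel_zero : 0 <= D -> (D != 0 -> a \in V1 /\ b \in V1) ->
  D = 0 \/ a != u \/ b != v -> forall z, net E2 x z = 0.
Proof.
move=> D0 abV1 H.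
have flow2 : is_flow E2 x (net E2 x u) u v.
  apply: (net_two_points T2) => z zu zv.
  have [zV2|zV2] := boolP (z \in V2); last exact: net_outside T2 _ _ zV2.
  have zV1 : z \notin V1.
    by apply/negP => /V12/(_ zV2)[] zE; rewrite zE eqxx in zu zv.
  move: (netE z); rewrite (net_outside T1) // add0r => ->.
  have [->|/abV1[aV bV]] := eqVneq D 0; first by rewrite mul0r.
  have [/negPf-> /negPf->] : z != a /\ z != b.
    by split; apply: contraNneq zV1 => ->.
  by rewrite subrr mulr0.
suff net0 : net E2 x u = 0 by move=> z; rewrite flow2 net0 mul0r.
have uv : u != v by case: T2.
have netv : net E2 x v = - net E2 x u.
  by rewrite flow2 eqxx eq_sym (negPf uv) sub0r mulrN1.
have := net_source_ge0 T1 x_ge0; have := net_source_ge0 T2 x_ge0.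
have := net_sink_le0 T1 x_ge0; have := net_sink_le0 T2 x_ge0.
have := netE v; have := netE u; rewrite netv.
case: H => [->|[/negPf au|/negPf bv]].
- by rewrite !mul0r; lra.
- by rewrite [u == a]eq_sym au; case: (u == b) => /=; lra.
- by rewrite [v == b]eq_sym bv; case: (v == a) => /=; lra.
Qed.

Lemma parallel_through : a = u -> b = v ->
  exists N : R, [/\ 0 <= N <= D, is_flow E1 x N u v & is_flow E2 x (D - N) u v].
Proof.
move=> aE bE; have uv : u != v by case: T2.
have E12 : net E2 x u = D - net E1 x u.
  by have := netE u; rewrite aE bE eqxx (negPf uv) /= => ?; lra.
have off z : z != u -> z != v -> net E1 x z = 0 /\ net E2 x z = 0.
  move=> zu zv; have := netE z; rewrite aE bE (negPf zu) (negPf zv) subrr mulr0.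
  have [zV1|zV1] := boolP (z \in V1); last first.
    by rewrite (net_outside T1) // add0r.
  rewrite (net_outside T2) ?addr0 //.
  by apply/negP => /(V12 zV1)[] zE; rewrite zE eqxx in zu zv.
exists (net E1 x u); split.
- have := net_source_ge0 T1 x_ge0; have := net_source_ge0 T2 x_ge0.
  by rewrite E12 => *; apply/andP; split; lra.
- by apply: (net_two_points T1) => z zu zv; case: (off z zu zv).
- by rewrite -E12; apply: (net_two_points T2) => z zu zv; case: (off z zu zv).
Qed.

(** Neither end is a terminal, so the sign conditions force zero balance of each part at [u] and
    [v]. Then [E1] can be unbalanced only at [a], hence nowhere, while its balance at [a] is [D]. *)
Lemma parallel_no_cross :
  a \in V1 -> a \notin V2 -> b \in V2 -> b \notin V1 -> D = 0.
Proof.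
move=> a1 a2 b2 b1.
have [uV1 vV1] : u \in V1 /\ v \in V1 by case: T1.
have [uV2 vV2] : u \in V2 /\ v \in V2 by case: T2.
have ua : (u == a) = false by apply: contraNF a2 => /eqP<-.
have va : (v == a) = false by apply: contraNF a2 => /eqP<-.
have ub : (u == b) = false by apply: contraNF b1 => /eqP<-.
have vb : (v == b) = false by apply: contraNF b1 => /eqP<-.
have ab : a != b by apply: contraNneq b1 => <-.
have net1 z : z != a -> net E1 x z = 0.
  move=> za; have [zV1|zV1] := boolP (z \in V1); last first.
    exact: net_outside T1 _ _ zV1.
  have := net_source_ge0 T1 x_ge0; have := net_source_ge0 T2 x_ge0.
  have := net_sink_le0 T1 x_ge0; have := net_sink_le0 T2 x_ge0.
  have := netE u; have := netE v; rewrite ua ub va vb subrr mulr0.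
  have [zV2|zV2] := boolP (z \in V2); first by case: (V12 zV1 zV2) => ->; lra.
  move=> _ _ _ _ _ _; have := netE z; rewrite (net_outside T2) // addr0 => ->.
  have /negPf-> : z != b by apply: contraNneq b1 => <-.
  by rewrite (negPf za) subrr mulr0.
have := net_sum0 E1 x; rewrite (bigD1 a) //= big1 // addr0.
have := netE a; rewrite (net_outside T2 _ a2) eqxx (negPf ab) /= => ? ?; lra.
Qed.

End Parallel.

(** A commodity other than [u] to [v] has its net flow in one part only. If its ends lie in both
    parts, [side] assigns it to the first. *)
Lemma parallel_local V1 E1 V2 E2 u v x D a b :
    terminals V1 E1 u v -> terminals V2 E2 u v ->
    V1 :&: V2 = [set u; v] -> [disjoint E1 & E2] ->
    (forall e, 0 <= x e) -> is_flow (E1 :|: E2) x D a b ->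
    0 <= D -> (D != 0 -> a \in V1 :|: V2 /\ b \in V1 :|: V2) ->
    ~~ ((a == u) && (b == v)) ->
  let side := (a \in V1) && (b \in V1) in
  [/\ is_flow E1 x (D * side%:R) a b, is_flow E2 x (D * (~~ side)%:R) a b
    & D != 0 -> ~~ side -> a \in V2 /\ b \in V2].
Proof.
move=> T1 T2 VV dE x0 xf D0 abV; rewrite negb_and => nthr side.
have VV' : V2 :&: V1 = [set u; v] by rewrite setIC.
have dE' : [disjoint E2 & E1] by rewrite disjoint_sym.
have xf' : is_flow (E2 :|: E1) x D a b by rewrite setUC.
have netE z : net E1 x z + net E2 x z = D * ((z == a)%:R - (z == b)%:R).
  by rewrite -xf netU.
have H : D = 0 \/ a != u \/ b != v by right; apply/orP.
have sideV : side -> a \in V1 /\ b \in V1 by case/andP.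
have notside : D != 0 -> ~~ side -> a \in V2 /\ b \in V2.
  move=> Dn0 ns.
  have [aV bV] := abV Dn0.
  have aV1 : a \notin V2 -> a \in V1.
    by move=> /negPf a2; move: aV; rewrite inE a2 orbF.
  have bV1 : b \notin V2 -> b \in V1.
    by move=> /negPf b2; move: bV; rewrite inE b2 orbF.
  have [a2|a2] := boolP (a \in V2); have [b2|b2] := boolP (b \in V2) => //.
  - case/eqP: Dn0; apply: (parallel_no_cross T2 T1 VV' dE' x0 xf') => //.
      by apply: contra ns => a1; rewrite /side a1 bV1.
    exact: bV1.
  - case/eqP: Dn0; apply: (parallel_no_cross T1 T2 VV dE x0 xf) => //.
      exact: aV1.
    by apply: contra ns => b1; rewrite /side b1 aV1.
  - by case/negP: ns; rewrite /side aV1 // bV1.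
have [Dz|Dn0] := eqVneq D 0.
  have z2 := parallel_zero T1 T2 VV dE x0 xf D0.
  have z1 := parallel_zero T2 T1 VV' dE' x0 xf' D0.
  rewrite Dz eqxx in z1 z2 *; split=> // z; rewrite !mul0r.
    by apply: z1 => //; left.
  by apply: z2 => //; left.
have [sd|sd] := boolP side.
  have z2 := parallel_zero T1 T2 VV dE x0 xf D0 (fun _ => sideV sd) H.
  split=> // z; rewrite ?mulr0 ?mul0r ?z2 // mulr1.
  by rewrite -netE z2 addr0.
have z1 := parallel_zero T2 T1 VV' dE' x0 xf' D0 (fun _ => notside Dn0 sd) H.
split=> [z|z|_ _]; rewrite ?mulr0 ?mul0r ?z1 ?mulr1 //.
  by rewrite -netE z1 add0r.
exact: notside.
Qed.

(** Commodities with common ends are interchangeable: their joint flow is shared out in proportion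
    to the new amounts [D], which leaves the total on each arc unchanged. *)
Lemma redistribute (I : finType) (thr : pred I) E (X : arcs G -> I -> R)
    (N D : I -> R) u v :
    (forall e l, 0 <= X e l) ->
    (forall l, thr l -> 0 <= N l /\ is_flow E (X^~ l) (N l) u v) ->
    (forall l, thr l -> 0 <= D l) ->
    \sum_(l | thr l) D l = \sum_(l | thr l) N l ->
  exists Y : arcs G -> I -> R,
    [/\ forall e l, 0 <= Y e l, forall l, thr l -> is_flow E (Y^~ l) (D l) u v,
      forall l e, ~~ thr l -> Y e l = X e l
      & forall e, \sum_l Y e l = \sum_l X e l].
Proof.
move=> X0 XN D0 DN; set F := \sum_(l | thr l) N l.
have N0 l : thr l -> 0 <= N l by case/XN.
have F0 : 0 <= F by apply: sumr_ge0.
(* With no flow to share, the proportions [D l / F] are meaningless, but all [N l] and [D l] vanish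
   and [X] itself serves. *)
have [Fz|Fn0] := eqVneq F 0.
  exists X; split=> // l tl z; case: (XN l tl) => _ ->.
  have -> : N l = 0 by apply: (psumr_eq0P N0).
  by have -> : D l = 0 by apply: (psumr_eq0P D0) => //; rewrite DN.
pose T e := \sum_(l | thr l) X e l.
have T0 e : 0 <= T e by apply: sumr_ge0.
exists (fun e l => if thr l then T e * (D l / F) else X e l); split.
- by move=> e l; case: ifP => // tl; rewrite mulr_ge0 ?divr_ge0 ?D0.
- move=> l tl z; rewrite tl netZ net_sum.
  rewrite (eq_bigr (fun l => N l * ((z == u)%:R - (z == v)%:R))).
    by rewrite -mulr_suml -/F [LHS]mulrC mulrA divfK.
  by move=> m /XN[_ ->].
- by move=> l e /negPf->.
- move=> e; rewrite (bigID thr) [RHS](bigID thr) /=; congr (_ + _).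
    rewrite (eq_bigr (fun l => T e * (D l / F))) => [|l ->//].
    by rewrite -mulr_sumr -mulr_suml DN divff // mulr1.
  by apply: eq_bigr => l /negPf->.
Qed.

End Flows.

(** * Random routings *)

Section Routings.
Variables (R : realFieldType) (G : digraph) (I : finType).
Variables (d : I -> R) (dm : R).
Hypotheses (d_gt0 : forall i, 0 < d i) (d_le : forall i, d i <= dm).
Implicit Types (S : pspace R) (V : {set nodes G}) (E : {set arcs G}).
Implicit Types (a b : I -> nodes G) (u v w : nodes G).

(** The fractional flow [X] carries expected demands, so that its arc totals are the means that the
    random routing has to meet. *)
Record random_instance V E u v S (B : I -> pred (outcome S)) a b
    (X : arcs G -> I -> R) : Prop := RandomInstance {
  ri_balanced : balanced B;
  ri_through : forall l, decided (B l) \/ a l = u /\ b l = v;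
  ri_nodes : forall l o, B l o -> a l \in V /\ b l \in V;
  ri_ge0 : forall e l, 0 <= X e l;
  ri_flow : forall l, is_flow E (X^~ l) (d l * pr (B l)) (a l) (b l)
}.

Definition routing E S (B : I -> pred (outcome S)) a b
    (p : outcome S -> I -> seq (arcs G)) : Prop :=
  forall o l, if B l o then dipath (a l) (p o l) (b l) && all [in E] (p o l)
              else p o l == [::].

Definition load S (p : outcome S -> I -> seq (arcs G)) e o : R :=
  \sum_l d l * (e \in p o l)%:R.

Definition close E (x : arcs G -> R) S
    (p : outcome S -> I -> seq (arcs G)) : Prop :=
  forall e, e \in E ->
    mean (load p e) = x e /\ forall o, `|load p e o - x e| < dm.

(** The statement proved by induction on the decomposition. Allowing any initial space and a
    refinement of it lets two components be routed one after the other. *)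
Definition routable V E u v : Prop :=
  forall S (B : I -> pred (outcome S)) a b X,
    random_instance V E u v B a b X ->
  exists (S' : pspace R) (h : outcome S' -> outcome S) p,
    [/\ refines h, routing E (fun l o => B l (h o)) a b p
      & close E (fun e => \sum_l X e l) p].

Lemma ri_refines V E u v S' S (h : outcome S' -> outcome S)
    (B : I -> pred (outcome S)) a b X :
    refines h -> random_instance V E u v B a b X ->
  random_instance V E u v (fun l o => B l (h o)) a b X.
Proof.
move=> rh [bB tB nB X0 fX]; split=> //.
- exact: balanced_refines.
- by move=> l; case: (tB l); [left; apply: decided_refines|right].
- by move=> l o; apply: nB.
- by move=> l; rewrite (pr_refines _ rh).
Qed.

Lemma routing_sub E S (B : I -> pred (outcome S)) a b p o l e :
  routing E B a b p -> e \in p o l -> e \in E.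
Proof.
by move/(_ o l); case: (B l o) => [/andP[_ /allP H] /H|/eqP->].
Qed.

Lemma load_refines S' S (h : outcome S' -> outcome S) E x p :
  refines h -> close E x p -> close E x (fun o => p (h o)).
Proof.
by move=> rh cp e /cp[<- dev]; split=> [|o]; [exact: rh|exact: dev].
Qed.

Lemma close_cat E1 E2 S x p q :
    [disjoint E1 & E2] ->
    (forall o l e, e \in p o l -> e \in E1) ->
    (forall o l e, e \in q o l -> e \in E2) ->
    close E1 x p -> close E2 x q ->
  close (S := S) (E1 :|: E2) x (fun o l => p o l ++ q o l).
Proof.
move=> dE pE qE clp clq e eE.
have load_eq p' : (forall o l, (e \in p o l ++ q o l) = (e \in p' o l)) ->
    load (fun o l => p o l ++ q o l) e =1 load p' e.
  by move=> H o; apply: eq_bigr => l _; rewrite H.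
move: eE; rewrite inE => /orP[e1|e2].
  have /load_eq lE o l : (e \in p o l ++ q o l) = (e \in p o l).
    rewrite mem_cat; case: (boolP (e \in q o l)) => [/qE|]; rewrite ?orbF //.
    by rewrite (disjointFr dE e1).
  have [<- dev] := clp e e1.
  by split=> [|o]; [exact: eq_mean|rewrite lE].
have /load_eq lE o l : (e \in p o l ++ q o l) = (e \in q o l).
  rewrite mem_cat; case: (boolP (e \in p o l)) => [/pE|]; rewrite ?orbF //.
  by rewrite (disjointFl dE e2).
have [<- dev] := clq e e2.
by split=> [|o]; [exact: eq_mean|rewrite lE].
Qed.

(** The second instance is pulled back to the space of the first routing and routed there; the first
    routing is then pulled back in turn. *)
Lemma routable_pair V1 E1 u1 v1 V2 E2 u2 v2 S (B1 B2 : I -> pred (outcome S))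
    a1 b1 a2 b2 X1 X2 x :
    routable V1 E1 u1 v1 -> routable V2 E2 u2 v2 -> [disjoint E1 & E2] ->
    random_instance V1 E1 u1 v1 B1 a1 b1 X1 ->
    random_instance V2 E2 u2 v2 B2 a2 b2 X2 ->
    (forall e, \sum_l X1 e l = x e) -> (forall e, \sum_l X2 e l = x e) ->
  exists (S' : pspace R) (h : outcome S' -> outcome S) p1 p2,
    [/\ refines h, routing E1 (fun l o => B1 l (h o)) a1 b1 p1,
      routing E2 (fun l o => B2 l (h o)) a2 b2 p2
      & close (E1 :|: E2) x (fun o l => p1 o l ++ p2 o l)].
Proof.
move=> r1 r2 dE i1 i2 x1 x2.
have [S1 [h1 [p1 [rh1 rt1 cl1]]]] := r1 _ _ _ _ _ i1.
have [S2 [h2 [p2 [rh2 rt2 cl2]]]] := r2 _ _ _ _ _ (ri_refines rh1 i2).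
have rt1' : routing E1 (fun l o => B1 l (h1 (h2 o))) a1 b1 (fun o => p1 (h2 o)).
  by move=> o l; apply: rt1.
exists S2, (fun o => h1 (h2 o)), (fun o => p1 (h2 o)), p2; split=> //.
  exact: refines_comp.
apply: close_cat => //.
- by move=> o l e; apply: routing_sub rt1'.
- by move=> o l e; apply: routing_sub rt2.
- by move=> e /(load_refines rh2 cl1); rewrite x1.
- by move=> e /cl2; rewrite x2.
Qed.

Lemma routable_arc e : src e != tgt e ->
  routable [set src e; tgt e] [set e] (src e) (tgt e).
Proof.
move=> st S B a b X [bB _ nB X0 fX].
(* A commodity with equal ends takes the empty path, so [B'] records which commodities load the
   arc. *)
pose B' l o := B l o && (a l != b l).
have bB' : balanced B'.
  apply: balanced_mix bB _ => l; rewrite /B'; have [_|_] := boolP (a l != b l).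
    by left=> o; rewrite andbT.
  by right; right=> o; rewrite andbF.
have XE l : X e l = d l * pr (B l) * ((src e == a l)%:R - (src e == b l)%:R).
  rewrite -fX net_set1 eqxx [tgt e == _]eq_sym (negPf st).
  by rewrite mul1r mul0r subr0.
(* The opposite orientation would make [X e l] negative. *)
have ends l o : B' l o -> a l = src e /\ b l = tgt e.
  case/andP=> Bo ab; move: (X0 e l) ab; rewrite XE.
  have D0 : 0 < d l * pr (B l) by rewrite mulr_gt0 // (pr_gt0 Bo).
  rewrite pmulr_rge0 //.
  have [/set2P[]-> /set2P[]->] := nB l o Bo; rewrite ?eqxx //.
  by rewrite (negPf st) sub0r oppr_ge0 ler10.
have XB l : X e l = d l * pr (B' l).
  rewrite XE; have [ab|ab] := eqVneq (a l) (b l).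
    rewrite ab subrr mulr0 (eq_pr (B := xpred0)) ?pr0 ?mulr0 // => o.
    by rewrite /B' ab eqxx andbF.
  have BB' : B' l =1 B l by move=> o; rewrite /B' ab andbT.
  rewrite (eq_pr BB'); case: (pickP (B l)) => [o Bo|B0].
    have [-> ->] : a l = src e /\ b l = tgt e by apply: (ends l o); rewrite BB'.
    by rewrite eqxx (negPf st) subr0 mulr1.
  by rewrite (eq_pr (B := xpred0)) // pr0 mulr0 mul0r.
exists S, id, (fun o l => if B' l o then [:: e] else [::]); split=> //.
  move=> o l; case: ifP => Bo; last by rewrite /B' Bo.
  case: ifPn => [/ends[-> ->]|].
    by rewrite /dipath /= !inE !eqxx (negPf st).
  by rewrite /B' Bo negbK => /eqP->; rewrite /dipath /= eqxx.
move=> e'; rewrite inE => /eqP->.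
have lE o : load (fun o l => if B' l o then [:: e] else [::]) e o =
    \sum_l d l * (B' l o)%:R.
  by apply: eq_bigr => l _; case: (B' l o); rewrite ?inE ?eqxx.
split=> [|o].
  rewrite (eq_mean lE) mean_sum; apply: eq_bigr => l _.
  by rewrite meanZ XB.
rewrite lE -sumrB (eq_bigr (fun l => d l * ((B' l o)%:R - pr (B' l)))).
  exact: (balanced_deviation d_gt0 d_le).
by move=> l _; rewrite XB mulrBr.
Qed.

(** * Composition of paths and induction along the decomposition *)

Lemma diwalk_cat (u w v : nodes G) p q :
  diwalk u p w -> diwalk w q v -> diwalk u (p ++ q) v.
Proof.
elim: p u => [|e p IHp] u /=; first by move/eqP->.
by case/andP=> -> pw qv; rewrite IHp.
Qed.

Lemma diwalk_last (u v : nodes G) p :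
  diwalk u p v -> last u [seq tgt e | e <- p] = v.
Proof.
by elim: p u => [|e p IHp] u /=; [move/eqP|case/andP=> _; exact: IHp].
Qed.

Lemma dipath_loop (u : nodes G) p : dipath u p u -> p = [::].
Proof.
case: p => // e p /andP[/diwalk_last/= lu /andP[/negP[]]].
by rewrite -{1}lu mem_last.
Qed.

Section SeriesPaths.
Variables (V1 V2 : {set nodes G}) (E1 E2 : {set arcs G}) (u w v : nodes G).
Hypotheses (T1 : terminals V1 E1 u w) (T2 : terminals V2 E2 w v).
Hypothesis VV : V1 :&: V2 = [set w].

Let V12 z : z \in V1 -> z \in V2 -> z = w.
Proof. by move=> z1 z2; apply/set1P; rewrite -VV inE z1. Qed.

Lemma dipath_cat (a b : nodes G) p q :
    a \in V1 -> dipath a p w -> dipath w q b ->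
    all [in E1] p -> all [in E2] q ->
  dipath a (p ++ q) b.
Proof.
move=> aV /andP[wp up] /andP[wq uq] /allP pE /allP qE.
move: uq; rewrite cons_uniq => /andP[wnq uq].
rewrite /dipath (diwalk_cat wp wq) map_cat -cat_cons cat_uniq up uq andbT.
apply/hasPn => z zq.
have zV2 : z \in V2.
  by case/mapP: zq => e /qE eE ->; case: T2 => _ _ _ /(_ e eE)[].
apply: contraNN wnq => zp; rewrite -(V12 _ zV2) //.
move: zp; rewrite inE => /orP[/eqP->//|/mapP[e /pE eE ->]].
by case: T1 => _ _ _ /(_ e eE)[].
Qed.

Lemma dipath_series (a b : nodes G) p q :
    a \in V1 :|: V2 -> b \in V1 :|: V2 ->
    dipath (retract V1 w a) p (retract V1 w b) -> all [in E1] p ->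
    dipath (retract V2 w a) q (retract V2 w b) -> all [in E2] q ->
  dipath a (p ++ q) b.
Proof.
have r1 z : z \in V1 -> retract V1 w z = z by rewrite /retract => ->.
have r2 z : z \in V2 -> retract V2 w z = z by rewrite /retract => ->.
have r12 z : z \in V2 -> retract V1 w z = w.
  by move=> z2; rewrite /retract; case: ifP => // z1; apply: V12.
have r21 z : z \in V1 -> retract V2 w z = w.
  by move=> z1; rewrite /retract; case: ifP => // z2; apply: V12.
rewrite !inE => aV bV.
have [a1|a1] := boolP (a \in V1).
  have [b1|b1] := boolP (b \in V1).
    by rewrite !r1 // !r21 // => pab _ /dipath_loop-> _; rewrite cats0.
  have b2 : b \in V2 by move: bV; rewrite (negPf b1).
  rewrite r1 // r12 // r21 // r2 // => pa pE qb qE.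
  exact: dipath_cat pa qb pE qE.
have a2 : a \in V2 by move: aV; rewrite (negPf a1).
have [b2|b2] := boolP (b \in V2).
  by rewrite !r12 // !r2 // => /dipath_loop->.
have b1 : b \in V1 by move: bV; rewrite (negPf b2) orbF.
(* Going from [V2] back to [V1] is impossible: the part in [E1] would start with an arc leaving [w],
   or be empty and put [b] in [V2]. *)
rewrite r12 // r1 //; case: p => [|e p] /=.
  move=> /andP[/eqP wb _] _ _ _; move: b2; rewrite -wb.
  by case: T2 => ->.
case/andP=> /andP[/eqP se _] _ /andP[eE _].
by case: T1 => _ _ _ /(_ e eE)[_ _ _]; rewrite se eqxx.
Qed.

End SeriesPaths.

(** Both parts inherit the events [B] and the flow [X], with ends retracted to the part. A commodity
    living on one side becomes a point on the other and takes the empty path there. *)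
Lemma routable_series V1 V2 E1 E2 u w v :
    terminals V1 E1 u w -> terminals V2 E2 w v ->
    V1 :&: V2 = [set w] -> [disjoint E1 & E2] ->
    routable V1 E1 u w -> routable V2 E2 w v ->
  routable (V1 :|: V2) (E1 :|: E2) u v.
Proof.
move=> T1 T2 VV dE rt1 rt2 S B a b X [bB tB nB X0 fX].
have [uV1 wV1] : u \in V1 /\ w \in V1 by case: T1.
have [wV2 vV2] : w \in V2 /\ v \in V2 by case: T2.
have V12 z : z \in V1 -> z \in V2 -> z = w.
  by move=> z1 z2; apply/set1P; rewrite -VV inE z1.
have rV V z : w \in V -> retract V w z \in V by rewrite /retract; case: ifP.
have i1 : random_instance V1 E1 u w B (fun l => retract V1 w (a l))
    (fun l => retract V1 w (b l)) X.
  split=> //.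
  - move=> l; case: (tB l) => [|[-> ->]]; [by left|right].
    rewrite /retract uV1; split=> //; case: ifP => // vV1; exact: V12.
  - by move=> l o _; split; apply: rV.
  - by move=> l; apply: (flow_series T1 T2 VV dE).
have i2 : random_instance V2 E2 w v B (fun l => retract V2 w (a l))
    (fun l => retract V2 w (b l)) X.
  split=> //.
  - move=> l; case: (tB l) => [|[-> ->]]; [by left|right].
    rewrite /retract vV2; split=> //; case: ifP => // uV2; exact: V12.
  - by move=> l o _; split; apply: rV.
  - move=> l; apply: (flow_series T2 T1); last by rewrite setUC.
      by rewrite setIC.
    by rewrite disjoint_sym.
have [//|//|S' [h [p [q [rh rtp rtq cl]]]]] := routable_pair
  (x := fun e => \sum_l X e l) rt1 rt2 dE i1 i2.
exists S', h, (fun o l => p o l ++ q o l); split=> // o l.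
move: (rtp o l) (rtq o l); case: ifP => [Bo|_ /eqP-> /eqP->//].
have [aV bV] := nB l (h o) Bo.
case/andP=> pp pE /andP[qq qE].
rewrite (dipath_series T1 T2 VV aV bV pp pE qq qE) all_cat /=.
apply/andP; split; [apply: sub_all pE|apply: sub_all qE] => e eE.
  by rewrite !inE eE.
by rewrite !inE eE orbT.
Qed.

(** Commodities from [u] to [v] are divided by [balanced_split], the others follow [side]. The
    division changes how much of each commodity a part carries but not the sum, so [redistribute]
    adapts [X] with the same arc totals. *)
Lemma routable_parallel V1 V2 E1 E2 u v :
    terminals V1 E1 u v -> terminals V2 E2 u v ->
    V1 :&: V2 = [set u; v] -> [disjoint E1 & E2] ->
    routable V1 E1 u v -> routable V2 E2 u v ->
  routable (V1 :|: V2) (E1 :|: E2) u v.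
Proof.
move=> T1 T2 VV dE rt1 rt2 S B a b X [bB tB nB X0 fX].
have [uV1 vV1] : u \in V1 /\ v \in V1 by case: T1.
have [uV2 vV2] : u \in V2 /\ v \in V2 by case: T2.
pose thr l := (a l == u) && (b l == v).
pose side l := (a l \in V1) && (b l \in V1).
have D0 l : 0 <= d l * pr (B l) by rewrite mulr_ge0 ?pr_ge0 ?ltW.
have thrE l : thr l -> a l = u /\ b l = v by case/andP=> /eqP-> /eqP->.
have Bdec l : ~~ thr l -> decided (B l).
  by move=> nt; case: (tB l) => // -[al bl]; rewrite /thr al bl !eqxx in nt.
have pr_pos l : d l * pr (B l) != 0 -> exists o, B l o.
  case: (pickP (B l)) => [o Bo _|B0]; first by exists o.
  by rewrite (eq_pr (B := xpred0)) // pr0 mulr0 eqxx.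
have local l : ~~ thr l ->
    [/\ is_flow E1 (X^~ l) (d l * pr (B l) * (side l)%:R) (a l) (b l),
      is_flow E2 (X^~ l) (d l * pr (B l) * (~~ side l)%:R) (a l) (b l)
      & forall o, B l o -> ~~ side l -> a l \in V2 /\ b l \in V2].
  move=> nt; have := parallel_local T1 T2 VV dE (X0^~ l) (fX l) (D0 l) _ nt.
  case=> [/pr_pos[o]|f1 f2 nV]; first exact: nB.
  split=> // o Bo; apply: nV; rewrite mulf_neq0 ?gt_eqF //.
  exact: pr_gt0 Bo.
have /fin_all_exists[N through] l : exists N : R, thr l ->
    [/\ 0 <= N <= d l * pr (B l), is_flow E1 (X^~ l) N u v
      & is_flow E2 (X^~ l) (d l * pr (B l) - N) u v].
  have [/thrE[al bl]|_] := boolP (thr l); last by exists 0.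
  have [N HN] := parallel_through T1 T2 VV dE (X0^~ l) (fX l) al bl.
  by exists N.
pose Bt l o := B l o && thr l.
have bBt : balanced Bt.
  apply: balanced_mix bB _ => l; rewrite /Bt; case: (thr l).
    by left=> o; rewrite andbT.
  by right; right=> o; rewrite andbF.
have prBt : \sum_l d l * pr (Bt l) = \sum_(l | thr l) d l * pr (B l).
  rewrite [RHS]big_mkcond; apply: eq_bigr => l _; rewrite /Bt.
  case: (thr l); first by congr (_ * _); apply: eq_pr => o; rewrite andbT.
  by rewrite (eq_pr (B := xpred0)) ?pr0 ?mulr0 // => o; rewrite andbF.
have [|S0 [h0 [C [rh0 CB prC bC bBC]]]] :=
    balanced_split d_gt0 bBt (f := \sum_(l | thr l) N l).
  rewrite prBt sumr_ge0 ?ler_sum // => l /through[/andP[N0 NB] _ _] //.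
have C0 l : ~~ thr l -> C l =1 xpred0.
  by move=> /negPf nt o; apply/negP => /CB; rewrite /Bt nt andbF.
have prCD l : pr (fun o => Bt l (h0 o) && ~~ C l o) = pr (Bt l) - pr (C l).
  have := prD (fun o => Bt l (h0 o)) (C l); rewrite (pr_refines _ rh0).
  rewrite (eq_pr (B := C l)) => [<-|o]; first by rewrite addrC addKr.
  by rewrite andb_idl //; apply: CB.
have sumC : \sum_(l | thr l) d l * pr (C l) = \sum_(l | thr l) N l.
  rewrite -prC [RHS](bigID thr) /= [X in _ + X]big1 ?addr0 // => l nt.
  by rewrite (eq_pr (C0 l nt)) pr0 mulr0.
have sumCD : \sum_(l | thr l) d l * pr (fun o => Bt l (h0 o) && ~~ C l o) =
    \sum_(l | thr l) (d l * pr (B l) - N l).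
  rewrite [RHS]sumrB -sumC -sumrB; apply: eq_bigr => l tl.
  rewrite prCD mulrBr; congr (_ * _ - _).
  by apply: eq_pr => o; rewrite /Bt tl andbT.
have [||Y1 [Y1_ge0 Y1f Y1l Y1E]] :=
    redistribute X0 _ _ sumC (E := E1) (u := u) (v := v).
- by move=> l /through[/andP[]].
- by move=> l _; rewrite mulr_ge0 ?pr_ge0 ?ltW.
have [||Y2 [Y2_ge0 Y2f Y2l Y2E]] :=
    redistribute X0 _ _ sumCD (E := E2) (u := u) (v := v).
- by move=> l /through[/andP[_ NB] _]; rewrite subr_ge0.
- by move=> l _; rewrite mulr_ge0 ?pr_ge0 ?ltW.
pose B1 l o := if thr l then C l o else B l (h0 o) && side l.
pose B2 l o := if thr l then B l (h0 o) && ~~ C l o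
               else B l (h0 o) && ~~ side l.
have side_decided l s : ~~ thr l -> decided (fun o => B l (h0 o) && s).
  by move=> nt; apply: decided_and; apply: decided_refines; apply: Bdec.
have pr_side l s : d l * pr (fun o => B l (h0 o) && s) =
    d l * pr (B l) * s%:R.
  case: s; rewrite ?mulr1 ?mulr0.
    rewrite -(pr_refines _ rh0); congr (_ * _).
    by apply: eq_pr => o; rewrite andbT.
  by rewrite (eq_pr (B := xpred0)) ?pr0 ?mulr0 // => o; rewrite andbF.
have i1 : random_instance V1 E1 u v B1 a b Y1.
  split=> //.
  - apply: balanced_mix bC _ => l; rewrite /B1.
    by case: (boolP (thr l)) => [_|nt]; [left|right; apply: side_decided].
  - move=> l; rewrite /B1; case: (boolP (thr l)) => [/thrE|nt]; first by right.
    by left; apply: side_decided.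
  - move=> l o; rewrite /B1.
    by case: (boolP (thr l)) => [/thrE[-> ->]|_ /andP[_ /andP[]]].
  - move=> l; rewrite /B1; case: (boolP (thr l)) => [tl|nt].
      by have [-> ->] := thrE l tl; apply: Y1f.
    rewrite pr_side => z; rewrite (eq_net (fun e _ => Y1l l e nt)).
    by case: (local l nt).
have i2 : random_instance V2 E2 u v B2 a b Y2.
  split=> //.
  - apply: balanced_mix bBC _ => l; rewrite /B2 /Bt.
    case: (boolP (thr l)) => [_|nt]; last by right; apply: side_decided.
    by left=> o; rewrite andbT.
  - move=> l; rewrite /B2; case: (boolP (thr l)) => [/thrE|nt]; first by right.
    by left; apply: side_decided.
  - move=> l o; rewrite /B2.
    case: (boolP (thr l)) => [/thrE[-> ->]//|nt /andP[Bo]].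
    by have [_ _] := local l nt; apply; exact: Bo.
  - move=> l; rewrite /B2; case: (boolP (thr l)) => [tl|nt].
      have [-> ->] := thrE l tl.
      rewrite (eq_pr (B := fun o => Bt l (h0 o) && ~~ C l o)).
        exact: Y2f.
      by move=> o; rewrite /Bt tl andbT.
    rewrite pr_side => z; rewrite (eq_net (fun e _ => Y2l l e nt)).
    by case: (local l nt).
have [S' [h [p [q [rh rtp rtq cl]]]]] := routable_pair rt1 rt2 dE i1 i2 Y1E Y2E.
exists S', (fun o => h0 (h o)), (fun o l => p o l ++ q o l); split=> //.
  exact: refines_comp.
(* A present commodity uses exactly one part, so one of the two concatenated paths is empty. *)
have BE o l : if B l (h0 (h o)) then B1 l (h o) (+) B2 l (h o)
              else ~~ B1 l (h o) && ~~ B2 l (h o).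
  move: (CB l (h o)); rewrite /B1 /B2 /Bt; case: (thr l).
    by case: (C l _); case: (B l _) => //= /(_ isT).
  by case: (B l _); case: (side l).
move=> o l; move: (rtp o l) (rtq o l) (BE o l); rewrite all_cat.
case: (B l _); case: (B1 l _); case: (B2 l _) => //=.
- move=> pp /eqP-> _; rewrite cats0 andbT; case/andP: pp => -> pE.
  by apply: sub_all pE => e; rewrite inE => ->.
- move=> /eqP-> /andP[qq qE] _; rewrite /= qq /=.
  by apply: sub_all qE => e; rewrite inE orbC => ->.
- by move=> /eqP-> /eqP->.
Qed.

Lemma sp_routable V E u v : sp_sub V E u v -> routable V E u v.
Proof.
elim=> {V E u v} [e|V1 V2 E1 E2 u w v sp1 rt1 sp2 rt2 VV dE
                 |V1 V2 E1 E2 u v sp1 rt1 sp2 rt2 VV dE].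
- exact: routable_arc.
- have [T1 T2] := (sp_terminals sp1, sp_terminals sp2).
  exact: routable_series T1 T2 VV dE rt1 rt2.
- have [T1 T2] := (sp_terminals sp1, sp_terminals sp2).
  exact: routable_parallel T1 T2 VV dE rt1 rt2.
Qed.

End Routings.

(** * From random routings to unsplittable multiflows *)

Lemma diwalk_balance (R : realFieldType) (G : digraph) (u v z : nodes G) p :
  diwalk u p v ->
  \sum_(e <- p) ((src e == z)%:R - (tgt e == z)%:R) =
    (z == u)%:R - (z == v)%:R :> R.
Proof.
elim: p u => [|e p IHp] u /=; first by move/eqP->; rewrite big_nil subrr.
case/andP=> /eqP<- pv; rewrite big_cons (IHp _ pv).
by rewrite [z == tgt e]eq_sym [z == src e]eq_sym addrA subrK.
Qed.

Lemma dipath_unsplittable (R : realType) (G : digraph) (k : nat)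
    (s t : 'I_k -> nodes G) (d : 'I_k -> R) (p : 'I_k -> seq (arcs G)) :
    is_instance s t d -> (forall i, dipath (s i) (p i) (t i)) ->
  is_unsplittable s t d (fun e i => d i * (e \in p i)%:R).
Proof.
case=> _ d_gt0 st _ sp; split.
- split=> [e i|z i]; first by rewrite mulr_ge0 // ltW.
  have /andP[wp up] := sp i.
  (* Distinct nodes give distinct arcs, so the sum along the path is a sum over a set of arcs. *)
  have {}up : uniq (p i) by apply: (@map_uniq _ _ (@tgt G)); case/andP: up.
  transitivity (d i * \sum_(e <- p i) ((src e == z)%:R - (tgt e == z)%:R)).
    rewrite -!mulr_sumr -mulrBr; congr (_ * _).
    rewrite big_uniq // [X in X - _]big_mkcond [X in _ - X]big_mkcond.
    rewrite [RHS]big_mkcond -sumrB /=.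
    apply: eq_bigr => e _; case: (e \in p i) => /=.
      by case: (src e == z); case: (tgt e == z).
    by case: (src e == z); case: (tgt e == z); rewrite subrr.
  rewrite (diwalk_balance _ _ wp); have [->|zs] := eqVneq z (s i).
    by rewrite (negPf (st i)) subr0 mulr1.
  by case: (z == t i); rewrite ?subrr ?mulr0 // sub0r mulrN1.
- by move=> e i; case: (e \in p i); rewrite ?mulr1 ?mulr0; [right|left].
- move=> i; exists (p i) => // e; case: (e \in p i); rewrite ?mulr1 ?mulr0 //.
  by split=> // /eqP; rewrite lt_eqF.
Qed.

Theorem theorem2 (R : realType) (G : digraph) (k : nat)
    (s t : 'I_k -> nodes G) (d : 'I_k -> R)
    (hG : series_parallel G) (hI : is_instance s t d)
    (X : arcs G -> 'I_k -> R) (hX : is_multiflow s t d X) :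
  convex_combination_of
    (fun y : arcs G -> R =>
       (exists2 Y : arcs G -> 'I_k -> R,
          is_unsplittable s t d Y & forall e : arcs G, y e = total_flow Y e) /\
       (forall e : arcs G,
          total_flow X e - max_demand d < y e < total_flow X e + max_demand d))
    (total_flow X).
Proof.
have [k_gt0 d_gt0 st _] := hI; have [X_ge0 Xbal] := hX.
have d_le i : d i <= max_demand d by apply: le_bigmax.
have [u [v spG]] := hG.
(* The start is the one-point space, where every commodity is surely present. *)
have w_gt0 (o : unit) : 0 < 1 :> R by [].
have w_sum1 : \sum_(o : unit) 1 = 1 :> R by rewrite sumr_const card_unit.
pose S0 := PSpace w_gt0 w_sum1.
pose B (l : 'I_k) (o : outcome S0) := true.
have ri : random_instance d setT setT u v B s t X.
  split=> //.
  - by exists (Ordinal k_gt0), (Ordinal k_gt0); split; [left|rewrite eqxx].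
  - by left; left.
  - move=> l z; rewrite prT mulr1.
    transitivity (\sum_(e | src e == z) X e l - \sum_(e | tgt e == z) X e l).
      by congr (_ - _); apply: eq_bigl => e; rewrite inE.
    rewrite Xbal; have [->|_] := eqVneq z (s l).
      by rewrite (negPf (st l)) subr0 mulr1.
    by case: (z == t l); rewrite ?subrr ?mulr0 // sub0r mulrN1.
have [S [h [p [_ rt cl]]]] := sp_routable d_gt0 d_le spG ri.
(* Each outcome contributes its routing, with its weight as the coefficient. *)
exists #|outcome S|, (fun j => weight (enum_val j)),
  (fun j e => load d p e (enum_val j)); split.
- by move=> j; apply/ltW/weight_gt0.
- rewrite -(big_enum_val (A := outcome S) (fun o => weight o)).
  exact: weight_sum1.
- move=> j; split.
    exists (fun e i => d i * (e \in p (enum_val j) i)%:R) => //.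
    by apply: dipath_unsplittable => // i; case/andP: (rt (enum_val j) i).
  move=> e; have [|_ /(_ (enum_val j))] := cl e; first by rewrite inE.
  by rewrite ltr_distl.
- move=> e; have [|lE _] := cl e; first by rewrite inE.
  rewrite -(big_enum_val (A := outcome S) (fun o => weight o * load d p e o)).
  exact: esym lE.
Qed.
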